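(* Let $\mathscr{Y}$ be a non-empty set and let $\overline{\mathrm{E}}$ be an upper expectation on $\overline{\mathscr{L}}(\mathscr{Y})$. If $\overline{\mathrm{E}}(f)=\lim_{c\to-\infty}\overline{\mathrm{E}}(f^{\vee c})$ for all $f\in\overline{\mathscr{L}}(\mathscr{Y})$, where $f^{\vee c}(y)=\max\{f(y),c\}$, then: (E2') $\overline{\mathrm{E}}(f+g)\le\overline{\mathrm{E}}(f)+\overline{\mathrm{E}}(g)$ for all $f,g\in\overline{\mathscr{L}}(\mathscr{Y})$; (E3') $\overline{\mathrm{E}}(\lambda f)=\lambda\overline{\mathrm{E}}(f)$ for all real $\lambda>0$ and all $f\in\overline{\mathscr{L}}(\mathscr{Y})$; (E4') $f\le g\Rightarrow\overline{\mathrm{E}}(f)\le\overline{\mathrm{E}}(g)$ for all $f,g\in\overline{\mathscr{L}}(\mathscr{Y})$.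
   Context: Notation: $\overline{\mathbb{R}}=\mathbb{R}\cup\{-\infty,+\infty\}$, with the conventions $+\infty-\infty=-\infty+\infty=+\infty$ and $0\cdot(\pm\infty)=0$ (the sums $f+g$ and $\overline{\mathrm{E}}(f)+\overline{\mathrm{E}}(g)$ use these); $\mathbb{N}_0=\{0,1,2,\dots\}$. $\overline{\mathscr{L}}(\mathscr{Y})$ is the set of all maps $\mathscr{Y}\to\overline{\mathbb{R}}$ and $\overline{\mathscr{L}}_b(\mathscr{Y})$ the subset of those bounded below by a real constant. Limits and inequalities of functions are pointwise. An upper expectation on $\overline{\mathscr{L}}(\mathscr{Y})$ is a map $\overline{\mathrm{E}}\colon\overline{\mathscr{L}}(\mathscr{Y})\to\overline{\mathbb{R}}$ such that: (E1) $\overline{\mathrm{E}}(c)=c$ for all $c\in\mathbb{R}$; (E2) $\overline{\mathrm{E}}(f+g)\le\overline{\mathrm{E}}(f)+\overline{\mathrm{E}}(g)$ for all $f,g\in\overline{\mathscr{L}}_b(\mathscr{Y})$; (E3) $\overline{\mathrm{E}}(\lambda f)=\lambda\overline{\mathrm{E}}(f)$ for all real $\lambda>0$ and $f\in\overline{\mathscr{L}}_b(\mathscr{Y})$; (E4) $f\le g\Rightarrow\overline{\mathrm{E}}(f)\le\overline{\mathrm{E}}(g)$ for all $f,g\in\overline{\mathscr{L}}_b(\mathscr{Y})$; (E5) $\lim_n\overline{\mathrm{E}}(f_n)=\overline{\mathrm{E}}(\lim_n f_n)$ for every non-decreasing sequence $\{f_n\}_{n\in\mathbb{N}_0}$ of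 non-negative variables in $\overline{\mathscr{L}}_b(\mathscr{Y})$. *)

(* Defs.v *)
From HB Require Import structures.
From mathcomp Require Import all_boot all_order all_algebra.
From mathcomp Require Import all_classical all_reals all_analysis.
Set Implicit Arguments.
Unset Strict Implicit.
Unset Printing Implicit Defensive.
Import Order.TTheory GRing.Theory Num.Theory.
Import numFieldNormedType.Exports.
Local Open Scope classical_set_scope.
Local Open Scope ring_scope.
Local Open Scope ereal_scope.

(* Sums are the dual addition [+] of [ereal_dual_scope], for which
   +oo + -oo = -oo + +oo = +oo; the ordinary [+] on [\bar R] gives -oo there.
   The product on [\bar R] already satisfies 0 * (+oo) = 0 * (-oo) = 0. *)

Definition bounded_below (R : realType) (Y : Type) (f : Y -> \bar R) : Prop :=
  exists c : R, forall y, c%:E <= f y.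

Definition cut_below (R : realType) (Y : Type) (f : Y -> \bar R) (c : R)
  : Y -> \bar R := fun y => maxe (f y) c%:E.

Record upper_expectation (R : realType) (Y : Type)
    (E : (Y -> \bar R) -> \bar R) : Prop := UpperExpectation {
  ue_cst : forall c : R, E (fun=> c%:E) = c%:E;
  ue_subadd : forall f g : Y -> \bar R,
    bounded_below f -> bounded_below g ->
    E (fun y => (f y + g y)%dE) <= (E f + E g)%dE;
  ue_homo : forall (l : R) (f : Y -> \bar R),
    (0 < l)%R -> bounded_below f -> E (fun y => l%:E * f y) = l%:E * E f;
  ue_mono : forall f g : Y -> \bar R,
    bounded_below f -> bounded_below g ->
    (forall y, f y <= g y) -> E f <= E g;
  (* The inner limit exists since each [f_ ^~ y] is non-decreasing. *)
  ue_cvg : forall f_ : nat -> Y -> \bar R,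
    (forall n, bounded_below (f_ n)) ->
    (forall n y, 0 <= f_ n y) ->
    (forall n y, f_ n y <= f_ n.+1 y) ->
    E (f_ n) @[n --> \oo] --> E (fun y => limn (fun n => f_ n y))
}.

(* Main.v *)
Require Import Defs.
From mathcomp Require Import all_boot all_order all_algebra.
From mathcomp Require Import all_classical all_reals all_analysis.
Import Order.TTheory GRing.Theory Num.Theory.
Import numFieldNormedType.Exports.
Import DualAddTheory.
Local Open Scope classical_set_scope.
Local Open Scope ring_scope.
Local Open Scope ereal_scope.

(** Every [cut_below f c] is bounded below, so the axioms apply to it, and [hcut] carries the
    resulting inequalities to the limit [c] to -oo. Monotonicity comes first, since cutting
    preserves order. It then gives [E f <= E (cut_below f c)], so the other two properties need only
    the pointwise bound of a function by its cuts: neither the sum nor the multiple is itself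
    cut. *)

Lemma bounded_below_cut (R : realType) (Y : Type) (f : Y -> \bar R) (c : R) :
  bounded_below (cut_below f c).
Proof. by exists c => y; rewrite /cut_below le_max lexx orbT. Qed.

Lemma le_cut_below (R : realType) (Y : Type) (f : Y -> \bar R) (c : R) (y : Y) :
  f y <= cut_below f c y.
Proof. by rewrite /cut_below le_max lexx. Qed.

(** Replaces passing to the limit in a dual sum, which is not continuous at opposite infinities. If
    [a] or [b] is +oo, so is the dual sum; otherwise the real sums [x + y] come down to [a + b]. *)
Lemma lee_dadd_lt (R : realType) (a b z : \bar R) :
  (forall x y : R, a < x%:E -> b < y%:E -> z <= (x + y)%:E) ->
  z <= (a + b)%dE.
Proof.
have lt_real (d : \bar R) : d < +oo -> exists x : R, d < x%:E.
  case: d => [r _| //|_]; last by exists 0%R; exact: ltNyr.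
  by exists (r + 1)%R; rewrite lte_fin ltrDl.
have [->|a_neqy] := eqVneq a +oo; first by rewrite daddye leey.
have [->|b_neqy] := eqVneq b +oo; first by rewrite daddey leey.
move=> h.
have [x ax] : exists x : R, a < x%:E by apply: lt_real; rewrite ltey.
have [y bx] : exists y : R, b < y%:E by apply: lt_real; rewrite ltey.
case: z h => [r h| h|]; [| by have := h _ _ ax bx | by rewrite leNye].
case: a a_neqy h ax => [s _ h _| //| _ h _]; last first.
  (* As [a] is -oo, [x] is unconstrained: choosing [x + y = r - 1] contradicts [r <= x + y]. *)
  have := h (r - 1 - y)%R y (ltNyr _) bx.
  by rewrite lee_fin subrK lerDl oppr_ge0 ler10.
case: b b_neqy h bx => [t _ h _| //| _ h _]; last first.
  (* Same contradiction, with [y] now unconstrained and [s + 1] any real above [a = s]. *)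
  have := h (s + 1)%R (r - 1 - (s + 1))%R _ (ltNyr _).
  rewrite lte_fin ltrDl ltr01 => /(_ isT).
  by rewrite lee_fin addrC subrK lerDl oppr_ge0 ler10.
rewrite -dEFinD; apply/lee_addgt0Pr => e e0.
have := h (s + e / 2)%R (t + e / 2)%R.
by rewrite !lte_fin !ltrDl divr_gt0// addrACA -splitr EFinD => /(_ isT isT).
Qed.

Theorem proposition1 (R : realType) (Y : Type) (Y0 : inhabited Y)
    (E : (Y -> \bar R) -> \bar R) (hE : upper_expectation E)
    (hcut : forall f : Y -> \bar R,
      E (cut_below f c) @[c --> (-oo_ R)%R] --> E f) :
  [/\ (forall f g : Y -> \bar R,
         E (fun y => (f y + g y)%dE) <= (E f + E g)%dE),
      (forall (l : R) (f : Y -> \bar R),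
         (0 < l)%R -> E (fun y => l%:E * f y) = l%:E * E f)
    & (forall f g : Y -> \bar R, (forall y, f y <= g y) -> E f <= E g)].
Proof.
have mono f g : (forall y, f y <= g y) -> E f <= E g.
  move=> fg; apply: (lee_cvg_to (hcut f) (hcut g)).
  apply: nearW => c; apply: (ue_mono hE); [exact: bounded_below_cut..|].
  by move=> y; rewrite /cut_below ge_max !le_max fg lexx orbT.
have homo_le (l : R) f : (0 < l)%R -> E (fun y => l%:E * f y) <= l%:E * E f.
  move=> l0; have lim_l := cvgeZl (erefl : l%:E \is a fin_num) (hcut f).
  (* [l * E f] is the limit of the values [l * E (cut_below f c)], so it suffices to bound each of
     these from below. *)
  apply: (cvge_ge _ lim_l); apply: nearW => c.
  rewrite -(ue_homo hE) //; last exact: bounded_below_cut.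
  by apply: mono => y; rewrite lee_pmul2l// le_cut_below.
split=> // [f g|l f l0].
- apply: lee_dadd_lt => a b fa gb.
  have near_lt h (d : R) : E h < d%:E ->
      \forall c \near (-oo_ R)%R, E (cut_below h c) < d%:E.
    by move=> hd; exact: (hcut h _ (open_ereal_lt' hd)).
  near (-oo_ R)%R => c.
  (* One [c] far enough down serves both functions: both cut expectations then lie below [a] and
     [b]. *)
  apply: (@le_trans _ _ (E (cut_below f c) + E (cut_below g c))%dE).
    apply: le_trans (ue_subadd hE (bounded_below_cut _ _ f c)
                                  (bounded_below_cut _ _ g c)).
    by apply: mono => y; apply: lee_dD; exact: le_cut_below.
  rewrite dEFinD; apply: lee_dD; apply: ltW; near: c; exact: near_lt.
- apply/eqP; rewrite eq_le homo_le//=.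
  (* The reverse inequality is [homo_le] for the factor [l^-1] and the function [l * f]. *)
  have lV0 : (0 < l^-1)%R by rewrite invr_gt0.
  rewrite -(@lee_pmul2l _ l^-1%:E)// muleA -EFinM mulVf ?gt_eqF// mul1e.
  apply: le_trans (homo_le _ _ lV0); apply: mono => y.
  by rewrite muleA -EFinM mulVf ?gt_eqF// mul1e.
Unshelve. all: by end_near.
Qed.
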